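(* Let $A$ be a unital C$^*$-algebra and let $T:A\to A$ be a continuous linear map which is a triple derivation at $1$ with $T(1)=0$. Then $T$ is a $^*$-derivation and a triple derivation.
   Context: For $a,b,c\in A$, $\{a,b,c\}=\frac12(ab^*c+cb^*a)$. A linear map $T:A\to A$ is a triple derivation at $z\in A$ if for all $a,b,c\in A$ with $\{a,b,c\}=z$ one has $T(z)=\{T(a),b,c\}+\{a,T(b),c\}+\{a,b,T(c)\}$. A triple derivation on $A$ is a linear map $\delta:A\to A$ with $\delta\{a,b,c\}=\{\delta(a),b,c\}+\{a,\delta(b),c\}+\{a,b,\delta(c)\}$ for all $a,b,c\in A$. A $^*$-derivation on $A$ is a linear map $D:A\to A$ with $D(ab)=D(a)b+aD(b)$ and $D(a^* )=D(a)^*$ for all $a,b\in A$. *)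

(* Defs.v *)
From HB Require Import structures.
From mathcomp Require Import all_boot all_order all_algebra.
From mathcomp Require Import complex.
From mathcomp Require Import all_classical all_reals all_analysis.

Set Implicit Arguments.
Unset Strict Implicit.
Unset Printing Implicit Defensive.

Import Order.TTheory GRing.Theory Num.Theory.
Import numFieldNormedType.Exports.

Local Open Scope ring_scope.
Local Open Scope complex_scope.

Reserved Notation "a ** b" (at level 40, left associativity).

(* Unital complex C*-algebras, as complex Banach spaces with a product, a unit
   and an involution.  The ring operations are mixin fields because the
   hierarchy has no join of rings with normed modules (numDomainType already
   inherits from both, with a norm valued in the ring itself).  The zero algebra
   is allowed.  The norm of a normed module over R[i] is valued in R[i]; it is
   nonnegative, hence real, and the (in)equalities between norms are in R[i]. *)
HB.mixin Record isCStarAlgebra (R : realType) A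
    of CompleteNormedModule R[i] A := {
  cstar_one : A;
  cstar_mul : A -> A -> A;
  star : A -> A;
  cstar_mulA : associative cstar_mul;
  cstar_mul1l : left_id cstar_one cstar_mul;
  cstar_mul1r : right_id cstar_one cstar_mul;
  cstar_mulDl : left_distributive cstar_mul +%R;
  cstar_mulDr : right_distributive cstar_mul +%R;
  cstar_scaleAl : forall (k : R[i]) (a b : A),
    k *: cstar_mul a b = cstar_mul (k *: a) b;
  cstar_scaleAr : forall (k : R[i]) (a b : A),
    k *: cstar_mul a b = cstar_mul a (k *: b);
  starD : {morph star : a b / a + b};
  starZ : forall (k : R[i]) (a : A), star (k *: a) = k^* *: star a;
  starM : forall a b : A, star (cstar_mul a b) = cstar_mul (star b) (star a);
  starK : involutive star;
  cstar_normM : forall a b : A, `|cstar_mul a b| <= `|a| * `|b|;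
  cstar_identity : forall a : A, `|cstar_mul (star a) a| = `|a| ^+ 2
}.

#[short(type="cstarAlgType")]
HB.structure Definition CStarAlgebra (R : realType) :=
  {A of isCStarAlgebra R A & CompleteNormedModule R[i] A}.

Arguments cstar_one {R} _.

Declare Scope cstar_scope.
Delimit Scope cstar_scope with cstar.
Notation "a ** b" := (cstar_mul a b) : cstar_scope.
Local Open Scope cstar_scope.

Definition triple_product (R : realType) (A : cstarAlgType R) (a b c : A) : A :=
  (2^-1 : R[i]) *: (a ** star b ** c + c ** star b ** a).

Definition triple_derivation_at (R : realType) (A : cstarAlgType R)
    (T : {linear A -> A}) (z : A) : Prop :=
  forall a b c : A, triple_product a b c = z ->
    T z = triple_product (T a) b c + triple_product a (T b) c
          + triple_product a b (T c).

Definition triple_derivation (R : realType) (A : cstarAlgType R)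
    (delta : {linear A -> A}) : Prop :=
  forall a b c : A,
    delta (triple_product a b c) =
      triple_product (delta a) b c + triple_product a (delta b) c
      + triple_product a b (delta c).

Definition star_derivation (R : realType) (A : cstarAlgType R)
    (D : {linear A -> A}) : Prop :=
  (forall a b : A, D (a ** b) = D a ** b + a ** D b) /\
  (forall a : A, D (star a) = star (D a)).

(* Main.v *)
Require Import Defs.
From HB Require Import structures.
From mathcomp Require Import all_boot all_order all_algebra.
From mathcomp Require Import complex.
From mathcomp Require Import all_classical all_reals all_analysis.
From mathcomp Require Import ring.
From Stdlib Require Ncring Ncring_tac.
Import GRing.Theory numFieldNormedType.Exports.
Import Order.TTheory Num.Theory.
Local Open Scope classical_set_scope.
Local Open Scope ring_scope.

(** The triple products equal to [1] that matter are those built from inverses: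
    if [a] is invertible with inverse [r], then [{a, 1, r} = 1] and
    [{a, star r, 1} = 1].  Since [T 1 = 0], writing [u o v = u v + v u], the
    hypothesis at these two factorizations gives
      [T a o r + a o T r = 0]   and   [T a o r + a o star (T (star r)) = 0].

    Subtracting, the defect [S x = T x - star (T (star x))] satisfies
    [a o S (a^-1) = 0], that is [S b o b = 0] for every invertible [b].  For
    small [y] the element [b = 1 - y] is invertible and [S b = - S y], so
    [2 S y = S y o y]; comparing this identity at [y] and at [2 y] forces
    [S y = 0].  Hence [T] commutes with the involution
    ([star_preserving]).

    For the product, take [a = 1 - y] in the first identity and expand
    [r = 1 + y + y^2 + ...].  The terms of degree at most one cancel, the terms
    of degree two form [2 (T (y^2) - T y o y)], and since [T] is bounded the
    rest is [O(|y|^3)].  Replacing [y] by [t x] and letting [t] tend to [0]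
    leaves [T (x^2) = T x o x]: the map [T] is a Jordan derivation
    ([jordan_of_triple_at_one]).

    A C*-algebra is semiprime, because [x (star x) x = 0] implies [x = 0] by the
    C*-identity, and a Jordan derivation of a 2-torsion free semiprime ring is a
    derivation ([jordan_leibniz], a theorem of Herstein, Cusack and Bresar).
    So [T] is a star-derivation, and applying the Leibniz rule to
    [a (star b) c + c (star b) a] shows that it is a triple derivation. *)

(** * Noncommutative ring normalization *)

#[local] Instance pzRing_Ncring_ops {R : pzRingType} :
  @Ncring.Ring_ops R 0 1 +%R *%R (fun x y => x - y) -%R eq := {}.

#[local] Instance pzRing_Ncring {R : pzRingType} :
  @Ncring.Ring R 0 1 +%R *%R (fun x y => x - y) -%R eq pzRing_Ncring_ops.
Proof.
split; try typeclasses eauto; try by move=> ? ? -> // ? ? ->.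
- exact: add0r.
- exact: addrC.
- exact: addrA.
- exact: mul1r.
- exact: mulr1.
- exact: mulrA.
- exact: mulrDl.
- by move=> x y z; apply: mulrDr.
- by [].
- exact: subrr.
Qed.

Ltac ncring := Ncring_tac.non_commutative_ring.

(** Reduces an equation that follows linearly from a known one to a ring
    identity, which [ncring] decides. *)
Lemma subr_transfer {R : pzRingType} {l m x y : R} : l = m -> x - y = l - m -> x = y.
Proof. by move=> -> e; apply/eqP; rewrite -subr_eq0 e subrr. Qed.

(** * Jordan derivations of semiprime rings *)

Section JordanDerivation.
Context {R : pzRingType} (D : R -> R).
Hypothesis two_torsion_free : forall x : R, x + x = 0 -> x = 0.
Hypothesis semiprime : forall a : R, (forall x, a * x * a = 0) -> a = 0.
Hypothesis additiveD : {morph D : x y / x + y}.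
Hypothesis jordanD : forall x, D (x * x) = D x * x + x * D x.

(** With [p = a x b], moving the factors of [p y p] across [a _ b = - b _ a]
    three times changes its sign, so [2 p y p = 0] for every [y]. *)
Lemma semiprime_skew (a b : R) :
  (forall x, a * x * b + b * x * a = 0) -> forall x, a * x * b = 0.
Proof.
move=> ab x; apply: semiprime => y; apply: two_torsion_free.
transitivity ((a * x * b + b * x * a) * y * a * x * b
   - (a * (x * a * y) * b + b * (x * a * y) * a) * x * b
   + a * x * (a * y * b + b * y * a) * x * b).
  by ncring.
by rewrite !ab !(mulr0, mul0r) subrr addr0.
Qed.

Lemma central_nilpotent3 (e : R) :
  (forall r, e * r = r * e) -> e * e * e = 0 -> e = 0.
Proof.
move=> ez e3; have e2 : e * e = 0.
  apply: semiprime => y.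
  transitivity (e * (e * y) * (e * e)); first by ncring.
  by rewrite ez -!mulrA (mulrA e e e) e3 !mulr0.
by apply: semiprime => y; rewrite -mulrA -ez mulrA e2 mul0r.
Qed.

Let D0 : D 0 = 0.
Proof. by apply: (addrI (D 0)); rewrite -additiveD !addr0. Qed.

Let DN x : D (- x) = - D x.
Proof. by apply: (addrI (D x)); rewrite -additiveD !subrr D0. Qed.

Lemma jordan_circ a b :
  D (a * b + b * a) = D a * b + a * D b + (D b * a + b * D a).
Proof.
have := jordanD (a + b).
have -> : (a + b) * (a + b) = a * a + (a * b + b * a) + b * b by ncring.
rewrite !additiveD !jordanD => H.
by apply: (subr_transfer H); ncring.
Qed.

(** Obtained from [2 a b a = a o (a o b) - (a a) o b], where
    [u o v = u v + v u]. *)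
Lemma jordan_triple a b :
  D (a * b * a) = D a * b * a + a * D b * a + a * b * D a.
Proof.
apply/eqP; rewrite -subr_eq0; apply/eqP/two_torsion_free.
have H := jordan_circ a (a * b + b * a).
have E : a * (a * b + b * a) + (a * b + b * a) * a =
  (a * a * b + b * (a * a)) + (a * b * a + a * b * a) by ncring.
move: H; rewrite E (additiveD (_ + b * _)) (jordan_circ (a * a)).
rewrite (additiveD (_ * a)) jordan_circ jordanD => H.
by apply: (subr_transfer H); ncring.
Qed.

Lemma jordan_triple_polar a b c :
  D (a * b * c + c * b * a) =
    D a * b * c + a * D b * c + a * b * D c +
    (D c * b * a + c * D b * a + c * b * D a).
Proof.
have := jordan_triple (a + c) b.
have -> : (a + c) * b * (a + c) =
  a * b * a + (a * b * c + c * b * a) + c * b * c by ncring.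
rewrite !additiveD !jordan_triple => H.
by apply: (subr_transfer H); ncring.
Qed.

Definition leibniz_defect a b := D (a * b) - (D a * b + a * D b).
Definition commutator (a b : R) := a * b - b * a.

Local Notation delta := leibniz_defect.
Local Notation comm := commutator.

Let deltaC a b : delta b a = - delta a b.
Proof.
have := jordan_circ a b; rewrite additiveD => H.
by rewrite /leibniz_defect; apply: (subr_transfer H); ncring.
Qed.

Let deltaDl a b c : delta (a + c) b = delta a b + delta c b.
Proof. by rewrite /leibniz_defect mulrDl !additiveD; ncring. Qed.

Let deltaDr a b c : delta a (b + c) = delta a b + delta a c.
Proof. by rewrite /leibniz_defect mulrDr !additiveD; ncring. Qed.

(** The element [a b x b a + b a x a b] is both a sum of two nested products
    of the form [u v u] and the polarized product of [a b], [x], [b a].  The two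
    resulting values of [D] differ exactly by the left-hand side. *)
Lemma delta_comm_skew a b x :
  delta a b * x * comm a b + comm a b * x * delta a b = 0.
Proof.
have : D (a * (b * x * b) * a + b * (a * x * a) * b) =
   D (a * b * x * (b * a) + b * a * x * (a * b)) by congr D; ncring.
rewrite additiveD !jordan_triple jordan_triple_polar.
have -> : D (b * a) = delta b a + (D b * a + b * D a) by rewrite /leibniz_defect; ncring.
rewrite deltaC.
have -> : D (a * b) = delta a b + (D a * b + a * D b) by rewrite /leibniz_defect; ncring.
by move=> H; apply: (subr_transfer H); rewrite /commutator; ncring.
Qed.

Let delta_comm a b x : delta a b * x * comm a b = 0.
Proof. exact: semiprime_skew _ _ (delta_comm_skew a b) x. Qed.

(** Linearizing [delta_comm] in one variable gives a skew relation between two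
    products; inserting it in [p y p], for [p] one of them, makes a factor
    vanish. *)
Let delta_comml a b c x : delta a b * x * comm c b = 0.
Proof.
have polar : delta a b * x * comm c b = - (delta c b * x * comm a b).
  have := delta_comm (a + c) b x; rewrite deltaDl => H.
  have H' : delta a b * x * comm a b + delta c b * x * comm c b = 0.
    by rewrite !delta_comm addr0.
  have {}H := etrans H (esym H').
  by apply: (subr_transfer H); rewrite /commutator; ncring.
apply: semiprime => y; rewrite {2}polar.
transitivity (- (delta a b * (x * comm c b * y * delta c b * x) * comm a b)).
  by ncring.
by rewrite delta_comm oppr0.
Qed.

Lemma delta_comm_all a b c d x : delta a b * x * comm c d = 0.
Proof.
have polar : delta a b * x * comm c d = - (delta a d * x * comm c b).
  have := delta_comml a (b + d) c x; rewrite deltaDr => H.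
  have H' : delta a b * x * comm c b + delta a d * x * comm c d = 0.
    by rewrite !delta_comml addr0.
  have {}H := etrans H (esym H').
  by apply: (subr_transfer H); rewrite /commutator; ncring.
apply: semiprime => y; rewrite {2}polar.
transitivity (- (delta a b * (x * comm c d * y * delta a d * x) * comm c b)).
  by ncring.
by rewrite delta_comml oppr0.
Qed.

(** For a defect [e] and [k = e r - r e], one has
    [k x k = e (r x) k - r (e x k)], and both terms vanish because [k] is itself
    a commutator. *)
Lemma delta_central a b r : delta a b * r = r * delta a b.
Proof.
apply/eqP; rewrite -subr_eq0; apply/eqP/semiprime => x.
rewrite -/(comm _ r) {1}/commutator.
transitivity (delta a b * (r * x) * comm (delta a b) r
              - r * (delta a b * x * comm (delta a b) r)); first by ncring.
by rewrite !delta_comm_all mulr0 subrr.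
Qed.

(** The defect [e] of the Leibniz rule at [(a, b)] is central and annihilates
    every commutator; let [c = a b - b a].  As the defect is skew in its
    arguments, [2 e = D c - [D a, b] - [a, D b]], hence [e D c = 2 e^2].
    Multiplying [0 = D (e c + c e)] by [e] gives [2 e (e D c) = 0], that is
    [4 e^3 = 0]; a semiprime ring has no nonzero central nilpotent, so
    [e = 0]. *)
Lemma jordan_leibniz a b : D (a * b) = D a * b + a * D b.
Proof.
apply/eqP; rewrite -subr_eq0; apply/eqP.
rewrite -/(delta a b); set e := delta a b; set c := comm a b.
have ez r : e * r = r * e by exact: delta_central.
have eC x u v : e * x * comm u v = 0 by exact: delta_comm_all.
have eC1 u v : e * comm u v = 0 by rewrite -(eC 1 u v) mulr1.
have eDc : e * D c = e * e + e * e.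
  have H : e * (comm (D a) b + comm a (D b)) = 0.
    by rewrite mulrDr !eC1 addr0.
  have E : delta a b - delta b a = e + e by rewrite (deltaC a b) opprK.
  have E' : e * (delta a b - delta b a) = e * (e + e) by rewrite E.
  have Dc : D c = D (a * b) - D (b * a) by rewrite /c /commutator additiveD DN.
  rewrite Dc; apply/esym.
  have K : e * (e + e) =
    e * (delta a b - delta b a) + e * (comm (D a) b + comm a (D b)).
    by rewrite H E' addr0.
  by apply: (subr_transfer K); rewrite /leibniz_defect /commutator; ncring.
have ec : e * c = 0 by exact: eC1.
have ecx x : e * x * c = 0 by exact: eC.
clearbody c.
have : e * (D e * c + e * D c + (D c * e + c * D e)) = 0.
  by rewrite -jordan_circ -(ez c) ec addr0 D0 mulr0.
rewrite -(ez (D c)) !mulrDr (mulrA e (D e)) ecx (mulrA e c) ec mul0r add0r addr0 eDc.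
move=> H; apply: (central_nilpotent3 _ ez).
apply: two_torsion_free; apply: two_torsion_free.
by apply: (subr_transfer H); ncring.
Qed.
End JordanDerivation.

(** * Vanishing of vectors with small norm *)

Lemma linear_small_eq0 {F : numFieldType} {V : normedModType F}
    (x : V) (K c : F) : 0 <= K -> 0 < c ->
  (forall t : F, 0 < t -> t <= c -> `|x| <= t * K) -> x = 0.
Proof.
move=> K0 c0 H; apply/eqP; case: (eqVneq x 0) => // x0.
have nx : 0 < `|x| by rewrite normr_gt0.
have cK0 : 0 <= c * K by rewrite mulr_ge0 // ltW.
have den : 0 < `|x| + c * K by rewrite ltr_wpDr.
pose q := `|x| / (`|x| + c * K) / 2.
have q0 : 0 < q by rewrite !divr_gt0.
have q1 : q <= 1.
  rewrite /q ler_pdivrMr // mul1r ler_pdivrMr //.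
  rewrite mulr_natl mulr2n -addrA lerDl; apply: addr_ge0 => //.
  exact: ltW.
(* The choice of [q] makes [c q K] at most half of [|x|]. *)
have := H (c * q) (mulr_gt0 c0 q0) _.
rewrite ger_pMr // => /(_ q1); rewrite mulrAC => le.
suff : c * K * q < `|x| by move/(le_lt_trans le); rewrite ltxx.
have -> : c * K * q = `|x| * (c * K / (`|x| + c * K) / 2).
  by rewrite /q !mulrA [c * K * _]mulrC !mulrA.
rewrite gtr_pMr // ltr_pdivrMr // mul1r ltr_pdivrMr //.
rewrite mulr_natl mulr2n ltr_pwDl // lerDr; exact: ltW.
Qed.

Lemma norm_small_eq0 {F : numFieldType} {V : normedModType F} (x : V) :
  (forall e : F, 0 < e -> `|x| <= e) -> x = 0.
Proof.
move=> H; apply: (linear_small_eq0 x 1 1) => // t t0 _.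
by rewrite mulr1 H.
Qed.

(** The field [R[i]] is only partially ordered; nonnegative elements are real,
    and the archimedean property is that of [R]. *)
Lemma complex_geometric_small {R : realType} (C e : R[i]) : 0 <= C -> 0 < e ->
  exists n, 2^-1 ^+ n * C < e.
Proof.
move=> C0 e0; have cre (z : R[i]) : 0 <= z -> z = (complex.Re z)%:C%C.
  by move=> /ger0_Im; case: z => a b /= ->.
have r0 : 0 < complex.Re e by move: e0; rewrite ltcE => /andP[].
pose n := (Num.truncn (complex.Re C / complex.Re e)).+1; exists n.
have n0 : 0 < 2 ^+ n :> R[i] by rewrite exprn_gt0.
rewrite exprVn mulrC ltr_pdivrMr //.
have lt : complex.Re C < complex.Re e * n%:R.
  rewrite mulrC -ltr_pdivrMr // /n.
  exact: truncnS_gt.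
apply: (@lt_trans _ _ (e * n%:R)); last first.
  by rewrite ltr_pM2l // -natrX ltr_nat ltn_expl.
rewrite [X in X < _]cre // [e in e * _]cre ?(ltW e0) //.
by rewrite -(rmorph_nat (real_complex R)) -rmorphM /= ltcR.
Qed.

(** * C*-algebras as rings *)

(** An alias of the C*-algebra that carries both its normed structure and a ring
    structure whose product is [cstar_mul], so that ring lemmas apply. *)
Definition cstar_ring {R : realType} (A : cstarAlgType R) : Type := A.

HB.instance Definition _ (R : realType) (A : cstarAlgType R) :=
  CStarAlgebra.copy (cstar_ring A) A.

HB.instance Definition _ (R : realType) (A : cstarAlgType R) :=
  GRing.Zmodule_isPzRing.Build (cstar_ring A)
    (@cstar_mulA R A) (@cstar_mul1l R A) (@cstar_mul1r R A)
    (@cstar_mulDl R A) (@cstar_mulDr R A).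

Section CStarRing.
Context {R : realType} {A : cstarAlgType R}.
Local Notation B := (cstar_ring A).
Implicit Types (x y z : B) (k : R[i]).

Lemma cstar_ring_normM x y : `|x * y| <= `|x| * `|y|.
Proof. exact: (@cstar_normM R A). Qed.

Lemma scale_mull k x y : (k *: x) * y = k *: (x * y).
Proof. by apply/esym; exact: (@cstar_scaleAl R A). Qed.

Lemma scale_mulr k x y : x * (k *: y) = k *: (x * y).
Proof. by apply/esym; exact: (@cstar_scaleAr R A). Qed.

Lemma cstar_ring_starM x y : star (x * y) = star y * star x :> B.
Proof. exact: (@starM R A). Qed.

Lemma cstar_ring_star1 : star (1 : B) = 1 :> B.
Proof.
by rewrite -[LHS]mulr1 -{2}(starK (1 : B)) -cstar_ring_starM mulr1 starK.
Qed.

Lemma star0 : star (0 : B) = 0 :> B.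
Proof. by apply: (addrI (star (0 : B) : B)); rewrite -starD !addr0. Qed.

Lemma cstar_two_torsion_free x : x + x = 0 -> x = 0.
Proof.
move=> xx; have : (2%:R : R[i]) *: x = 0 by rewrite scaler_nat mulr2n.
by move/eqP; rewrite scaler_eq0 pnatr_eq0 /= => /eqP.
Qed.

Lemma cstar_star_mul_eq0 x : star x * x = 0 :> B -> x = 0.
Proof.
move=> xx; apply/eqP; rewrite -normr_eq0 -sqrf_eq0.
by rewrite -(cstar_identity x) -[cstar_mul _ _]/(star x * x : B) xx normr0.
Qed.

(** If [x y x = 0] for all [y], then [z = (star x) x] satisfies
    [(star z) z = 0], and the C*-identity applies twice. *)
Lemma cstar_semiprime x : (forall y, x * y * x = 0) -> x = 0.
Proof.
move=> xyx; apply: cstar_star_mul_eq0; apply: cstar_star_mul_eq0.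
by rewrite cstar_ring_starM starK -mulrA (mulrA x) xyx mulr0.
Qed.

(** The Neumann series: [s n] is the sum of [y^i] for [i < n], built by the
    recursion [s n.+1 = 1 + y * s n], so that the limit satisfies
    [r = 1 + y * r].  The bound on [r] follows from this equation. *)
Lemma neumann_inverse y : `|y| <= 2^-1 -> exists r : B,
  [/\ (1 - y) * r = 1, r * (1 - y) = 1 & `|r| <= 2 * `|1 : B|].
Proof.
move=> ylt; pose s n : B := iter n (fun z => 1 + y * z) 0.
pose L := `|1 : B|.
have half_sum (u : R[i]) : u + 2^-1 * (2 * u) = 2 * u.
  by rewrite mulKf ?pnatr_eq0 // mulr_natl mulr2n.
have yM z : `|y * z| <= 2^-1 * `|z|.
  by apply: le_trans (cstar_ring_normM _ _) _; rewrite ler_wpM2r.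
have sL n : `|s n| <= 2 * L.
  elim: n => [|n IH] /=; first by rewrite normr0 mulr_ge0 ?normr_ge0 ?ler0n.
  apply: le_trans (ler_normD _ _) _; rewrite -[leRHS]half_sum lerD2l.
  by apply: le_trans (yM _) _; rewrite ler_wpM2l ?invr_ge0 ?ler0n.
have sD n m : `|s n - s (n + m)%N| <= 2^-1 ^+ n * (2 * L).
  elim: n => [|n IH] /=.
    by rewrite add0n sub0r normrN expr0 mul1r.
  have -> : 1 + y * s n - (1 + y * s (n + m)%N) = y * (s n - s (n + m)%N) by ncring.
  by apply: le_trans (yM _) _; rewrite exprS -mulrA ler_wpM2l ?invr_ge0.
have comm n : y * s n = s n * y.
  elim: n => [|n IH] /=; first by rewrite mulr0 mul0r.
  by rewrite mulrDr mulrDl mulr1 mul1r {1}IH mulrA.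
have : cvg (s @ \oo).
  apply: cauchy_cvg; apply: cauchy_exP => e e0.
  have [n ne] := complex_geometric_small (2 * L) e (mulr_ge0 (ler0n _ 2) (normr_ge0 _)) e0.
  exists (s n); exists n => // k /= nk; rewrite -ball_normE /=.
  by apply: le_lt_trans ne; rewrite -(subnKC nk).
move=> /cvg_ex[/= r sr]; exists r.
have near_r e : 0 < e -> exists n, `|r - s n| < e /\ `|r - s n.+1| < e.
  move=> e0; have /cvgrPdist_lt/(_ e e0)[n _ H] := sr.
  by exists n; split; apply: H => /=.
have rE : r = 1 + y * r.
  apply/eqP; rewrite -subr_eq0; apply/eqP/norm_small_eq0 => e e0.
  have [n [H1 H2]] := near_r _ (divr_gt0 e0 (ltr0n _ 2)).
  have -> : r - (1 + y * r) = (r - s n.+1) - y * (r - s n) by rewrite /=; ncring.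
  rewrite (splitr e); apply: le_trans (ler_normB _ _) _; apply: lerD; first exact: ltW.
  apply: le_trans (yM _) _; apply: le_trans (ltW H1).
  by rewrite ler_piMl // invf_le1 // ler1n.
have ry : r * y = y * r.
  apply/eqP; rewrite -subr_eq0; apply/eqP/norm_small_eq0 => e e0.
  have [n [H1 _]] := near_r _ e0.
  have -> : r * y - y * r = (r - s n) * y - y * (r - s n).
    by rewrite mulrBl mulrBr comm; ncring.
  have half : `|r - s n| * 2^-1 + 2^-1 * `|r - s n| <= e.
    rewrite mulrC -mulrDr -mulr2n -[X in _ * X]mulr_natl mulKf ?pnatr_eq0 //.
    exact: ltW.
  apply: le_trans (ler_normB _ _) _; apply: le_trans half; apply: lerD => //.
  by apply: le_trans (cstar_ring_normM _ _) _; rewrite ler_wpM2l.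
have inv : (1 - y) * r = 1.
  by rewrite mulrBl mul1r {1}rE addrK.
split=> //; first by rewrite mulrBr mulr1 ry -[r in r - _]mul1r -mulrBl.
have : `|1 + y * r| <= `|1 : B| + `|y * r| by exact: ler_normD.
rewrite -rE => /le_trans/(_ (lerD (lexx _) (yM r))).
rewrite -lerBlDr -{1}[`|r|]mul1r -mulrBl.
have -> : (1 - 2^-1 : R[i]) = 2^-1 by rewrite {1}(splitr 1) mul1r addrK.
by rewrite mulrC ler_pdivrMr // mulrC.
Qed.

Lemma half_scale x : 2^-1 *: (x + x) = x :> B.
Proof. by rewrite -mulr2n -[x *+ 2]scaler_nat scalerA mulVf ?pnatr_eq0 // scale1r. Qed.

Lemma triple_inverse (a b c : B) :
  a * star b * c = 1 -> c * star b * a = 1 -> triple_product a b c = 1 :> B.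
Proof.
by move=> ac ca; rewrite -[LHS]/(2^-1 *: (a * star b * c + c * star b * a)) ac ca half_scale.
Qed.

(** * Maps that are triple derivations at the unit *)

Section TripleDerivationAtOne.
Context (f : {linear B -> B}).
Hypothesis f_triple : triple_derivation_at f (1 : B).
Hypothesis f_one : f 1 = 0.

Lemma triple_at_one_expand (a b c : B) :
  a * star b * c = 1 -> c * star b * a = 1 ->
  f a * star b * c + c * star b * f a + (a * star (f b) * c + c * star (f b) * a)
  + (a * star b * f c + f c * star b * a) = 0.
Proof.
move=> ac ca.
have := f_triple a b c (triple_inverse a b c ac ca).
rewrite f_one /triple_product -!scalerDr => /esym/eqP.
by rewrite scaler_eq0 invr_eq0 pnatr_eq0 /= => /eqP.
Qed.

(** The factorization [{a, 1, r} = 1]. *)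
Lemma inverse_circ (a r : B) : a * r = 1 -> r * a = 1 ->
  f a * r + r * f a + (a * f r + f r * a) = 0.
Proof.
move=> ar ra; have := triple_at_one_expand a 1 r.
rewrite cstar_ring_star1 f_one star0 !mulr1 !mulr0 !mul0r !addr0.
exact.
Qed.

Definition star_defect x : B := f x - star (f (star x)).

Lemma star_defectD : {morph star_defect : x y / x + y}.
Proof. by move=> x y; rewrite /star_defect !(starD, linearD); ncring. Qed.

(** The factorization [{a, star r, 1} = 1], compared with [{a, 1, r} = 1]. *)
Lemma star_defect_inverse (a r : B) : a * r = 1 -> r * a = 1 ->
  a * star_defect r + star_defect r * a = 0.
Proof.
move=> ar ra.
have H := inverse_circ a r ar ra.
have := triple_at_one_expand a (star r) 1.
rewrite starK !mul1r !mulr1 f_one !mulr0 !mul0r !addr0 => /(_ ar ra) K.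
have {}H := etrans H (esym K).
by apply: (subr_transfer H); rewrite /star_defect; ncring.
Qed.

(** For [s] the defect at a small [y], multiplying the relation of
    [star_defect_inverse] at [b = 1 - y] by [b] on both sides removes the
    inverse and gives [2 s = s o y]; at [2 y] it reads [4 s = 4 (s o y)].
    Together they give [s o y = 0] and [s = 0].  The proof takes [y] to be half
    of the given vector. *)
Lemma star_defect_small x : `|x| <= 2^-1 -> star_defect x = 0.
Proof.
have key y : `|y| <= 2^-1 ->
    star_defect y + star_defect y = star_defect y * y + y * star_defect y.
  move=> /neumann_inverse [r [yr ry _]].
  have := star_defect_inverse r (1 - y) ry yr.
  have S1 : star_defect 1 = 0.
    by rewrite /star_defect cstar_ring_star1 f_one star0 subrr.
  have E : star_defect 1 = star_defect (1 - y) + star_defect y.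
    by rewrite -star_defectD subrK.
  rewrite S1 in E; have -> : star_defect (1 - y) = - star_defect y.
    by apply: (addIr (star_defect y)); rewrite -E addNr.
  set s := star_defect y => H.
  have : (1 - y) * (r * - s + - s * r) * (1 - y) = 0 by rewrite H mulr0 mul0r.
  have -> : (1 - y) * (r * - s + - s * r) * (1 - y) =
     - ((1 - y) * r * s * (1 - y) + (1 - y) * s * (r * (1 - y))) by ncring.
  by rewrite yr ry => {}H; apply/esym; apply: (subr_transfer H); ncring.
move=> x2; pose y : B := 2^-1 *: x.
have xy : x = y + y by rewrite -scalerDr half_scale.
have y2 : `|y| <= 2^-1.
  rewrite normrZ ger0_norm ?invr_ge0 ?ler0n // (le_trans _ x2) //.
  by rewrite ler_piMl // invf_le1 // ler1n.
have := key x x2; have := key y y2; rewrite xy star_defectD.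
set s := star_defect y => H K.
have E : (s + s) * (y + y) + (y + y) * (s + s) = s * y + y * s + (s * y + y * s).
  by rewrite -K H.
rewrite H; apply: cstar_two_torsion_free.
by apply: (subr_transfer E); ncring.
Qed.

Lemma exists_small_scale x : exists2 c : R[i], 0 < c &
  forall t : R[i], 0 < t -> t <= c -> `|t *: x| <= 2^-1.
Proof.
have d0 : 0 < 1 + `|x| by rewrite ltr_pwDl.
exists (2^-1 / (1 + `|x|)); first by rewrite !divr_gt0 // invr_gt0 ltr0n.
move=> t t0; rewrite ler_pdivlMr // normrZ gtr0_norm // => /(le_trans _); apply.
by rewrite ler_wpM2l ?(ltW t0) // lerDr.
Qed.

Lemma star_preserving x : f (star x) = star (f x).
Proof.
have [c c0 /(_ c c0 (lexx c))/star_defect_small] := exists_small_scale (star x).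
rewrite /star_defect !starZ starK !linearZ /= starZ conjCK -scalerBr.
by move=> /eqP; rewrite scaler_eq0 gt_eqF //= subr_eq0 => /eqP.
Qed.

(** The relation [inverse_circ] at [a = 1 - y] with [r] replaced by
    [1 + y + y^2 r] in the factors of [f y] and by [1 + y + y^2 + y^3 r] inside
    [f].  The left side is twice the Jordan defect, and the right side has
    degree at least three in [y]. *)
Lemma jordan_remainder (y r : B) : (1 - y) * r = 1 -> r * (1 - y) = 1 ->
  f (y * y) - (f y * y + y * f y) + (f (y * y) - (f y * y + y * f y)) =
  f y * (y * y * r) + y * y * r * f y - (f (y * y * y * r) + f (y * y * y * r))
  + (y * f (y * y) + f (y * y) * y)
  + (y * f (y * y * y * r) + f (y * y * y * r) * y).
Proof.
move=> yr ry; have H := inverse_circ _ _ yr ry.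
have r1 : r = 1 + y * r.
  by rewrite -{1}yr; ncring.
have r3 : r = 1 + y + y * y + y * y * y * r.
  by rewrite {1}r1 {1}r1 {1}r1; ncring.
have r2 : r = 1 + y + y * y * r.
  by rewrite {1}r1 {1}r1; ncring.
have fy : f (1 - y) = - f y.
  by apply: (addIr (f y)); rewrite -linearD subrK f_one addNr.
have fr : f r = f y + f (y * y) + f (y * y * y * r).
  by rewrite {1}r3 !linearD f_one add0r.
move: H; rewrite fy fr; set u := f (y * y * y * r); set v := f (y * y).
have -> : - f y * r = - f y * (1 + y + y * y * r) by rewrite -r2.
have -> : r * - f y = (1 + y + y * y * r) * - f y by rewrite -r2.
by move=> H; apply: (subr_transfer H); ncring.
Qed.

Hypothesis f_continuous : continuous f.

Lemma linear_bound : exists2 M : R[i], 0 < M & forall x, `|f x| <= M * `|x|.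
Proof.
have /linear_boundedP/pinfty_ex_gt0[M M0 H] := continuous_linear_bounded 0 (f_continuous 0).
by exists M.
Qed.

Lemma jordan_remainder_bound : exists2 K : R[i], 0 <= K & forall y,
  `|y| <= 2^-1 ->
  `|f (y * y) - (f y * y + y * f y) + (f (y * y) - (f y * y + y * f y))|
    <= K * `|y| ^+ 3.
Proof.
have [M M0 fM] := linear_bound.
pose L := 2 * `|1 : B|.
have L0 : 0 <= L by rewrite mulr_ge0.
exists (M * (L + L + (L + L) + (1 + 1) + (L + L))).
  by rewrite mulr_ge0 ?(ltW M0) // !addr_ge0.
move=> y y2; have [r [yr ry rL]] := neumann_inverse y y2.
rewrite (jordan_remainder y r yr ry); set N := `|y|.
have N0 : 0 <= N by exact: normr_ge0.
have N1 : N <= 1 by apply: le_trans y2 _; rewrite invf_le1 // ler1n.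
have mul_le (u v : B) (a b : R[i]) : `|u| <= a -> `|v| <= b -> `|u * v| <= a * b.
  by move=> ua vb; apply: le_trans (cstar_ring_normM _ _) _; rewrite ler_pM.
have f_le (u : B) (a : R[i]) : `|u| <= a -> `|f u| <= M * a.
  by move=> ua; apply: le_trans (fM u) _; rewrite ler_pM2l.
have yN : `|y| <= N by [].
have yy := mul_le _ _ _ _ yN yN.
have yyr := mul_le _ _ _ _ yy rL.
have fyyyr := f_le _ _ (mul_le _ _ _ _ (mul_le _ _ _ _ yy yN) rL).
(* The bound split along the summands of [jordan_remainder]; the last two have
   degree four, and [N <= 1] brings them down to degree three. *)
have -> : M * (L + L + (L + L) + (1 + 1) + (L + L)) * N ^+ 3 =
  M * N * (N * N * L) + N * N * L * (M * N)
  + (M * (N * N * N * L) + M * (N * N * N * L))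
  + (N * (M * (N * N)) + M * (N * N) * N)
  + (M * (N * N * N * L) + M * (N * N * N * L)) by ring.
have tail (u : B) : `|u| <= N * (M * (N * N * N * L)) -> `|u| <= M * (N * N * N * L).
  by move=> /le_trans; apply; rewrite ler_piMl // !mulr_ge0 // ltW.
apply: le_trans (ler_normD _ _) _; apply: lerD; last first.
  apply: le_trans (ler_normD _ _) _; apply: lerD; apply: tail.
    exact: mul_le.
  by rewrite mulrC; exact: mul_le.
apply: le_trans (ler_normD _ _) _; apply: lerD; last first.
  by apply: le_trans (ler_normD _ _) _; apply: lerD; apply: mul_le => //; exact: f_le.
apply: le_trans (ler_normB _ _) _; apply: lerD; last first.
  by apply: le_trans (ler_normD _ _) _; apply: lerD.
apply: le_trans (ler_normD _ _) _; apply: lerD; apply: mul_le => //; exact: f_le.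
Qed.

(** The Jordan defect is quadratic in [x] and bounded by a cubic near [0]. *)
Lemma jordan_of_triple_at_one x : f (x * x) = f x * x + x * f x.
Proof.
apply/eqP; rewrite -subr_eq0; apply/eqP/cstar_two_torsion_free.
have [K K0 HK] := jordan_remainder_bound.
have [c c0 cx] := exists_small_scale x.
apply: (linear_small_eq0 _ (K * `|x| ^+ 3) c) => //.
  by rewrite mulr_ge0 // exprn_ge0.
move=> t t0 tc; have := HK _ (cx t t0 tc).
rewrite !(scale_mull, scale_mulr, linearZZ).
rewrite !(scalerA, =^~ scalerDr, =^~ scalerBr) -expr2.
rewrite !normrZ (gtr0_norm t0).
have -> : K * (t * `|x|) ^+ 3 = t * t * (t * (K * `|x| ^+ 3)) by ring.
by rewrite ler_pM2l // mulr_gt0.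
Qed.

End TripleDerivationAtOne.

Lemma triple_productE (x y z : B) :
  triple_product x y z = 2^-1 *: (x * star y * z + z * star y * x) :> B.
Proof. by []. Qed.

Lemma star_derivation_triple (f : {linear B -> B}) :
  star_derivation f -> triple_derivation f.
Proof.
move=> [fM fstar] a b c; rewrite !triple_productE linearZZ -!scalerDr.
have {}fM x y : f (x * y) = f x * y + x * f y by exact: fM.
congr (_ *: _); rewrite linearD !fM !fstar; ncring.
Qed.

End CStarRing.

Theorem proposition2p4 (R : realType) (A : cstarAlgType R)
    (T : {linear A -> A}) (T_continuous : continuous T)
    (T_triple : triple_derivation_at T (cstar_one A))
    (T_one : T (cstar_one A) = 0) :
  star_derivation T /\ triple_derivation T.
Proof.
pose f : {linear cstar_ring A -> cstar_ring A} := T.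
have f_star (x : cstar_ring A) : f (star x) = star (f x).
  exact: star_preserving f T_triple T_one x.
have f_jordan x : f (x * x) = f x * x + x * f x.
  exact: jordan_of_triple_at_one f T_triple T_one T_continuous x.
have fM := jordan_leibniz f cstar_two_torsion_free cstar_semiprime
  (linearD f) f_jordan.
have f_der : star_derivation f by split.
by split; [exact: f_der | exact: star_derivation_triple f_der].
Qed.
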